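(* Let $G=(V,E)$ be a finite simple connected undirected graph and let $\mu,\nu:V\to\mathbb{R}$ be fixed probability density vectors. For each spanning tree $T\in\mathcal{T}(G)$, let $\mathsf{k}[T]\in\mathbb{R}_{\ge 0}^{E'}$ denote the canonical embedding vector of $T$, and let $\mathcal{K}(\mu,\nu)=\mathrm{conv}\{\mathsf{k}[T]:T\in\mathcal{T}(G)\}$ be the $(\mu,\nu)$-tree polytope. Then the following statements hold. (i) For each spanning tree $T\in\mathcal{T}(G)$, $\mathsf{k}[T]$ is a vertex of $\mathcal{K}(\mu,\nu)$. (ii) For each vertex $K$ of $\mathcal{K}(\mu,\nu)$, there exists at least one spanning tree $T\in\mathcal{T}(G)$ such that $K=\mathsf{k}[T]$. Moreover, the support of $K$, i.e., the set $F$ of edges $\{x,y\}\in E$ such that $K$ is positive on at least one of the two orientations $(x,y),(y,x)$, forms a forest in $G$, and the fiber $\mathsf{k}^{-1}[K]=\{T\in\mathcal{T}(G):\mathsf{k}[T]=K\}$ consists of all spanning trees $T$ of $G$ containing $F$.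
   Context: A probability density vector on $V$ is a function $\mu:V\to\mathbb{R}$ with nonnegative values summing to $1$. A spanning tree of $G$ is a set $T\subseteq E$ such that $(V,T)$ is connected and acyclic; $\mathcal{T}(G)$ is the set of spanning trees. Let $E'=\{(x,y),(y,x):\{x,y\}\in E\}$ be the set of directed (bi-oriented) edges. For $T\in\mathcal{T}(G)$, the canonical embedding $\mathsf{k}[T]\in\mathbb{R}_{\ge0}^{E'}$ is defined for $(x,y)\in E'$ by $\mathsf{k}[T](x,y)=\max\{\sum_{z\in S_x}(\mu(z)-\nu(z)),0\}$ if $\{x,y\}\in T$, where $S_x$ is the vertex set of the connected component of $(V,T\setminus\{\{x,y\}\})$ containing $x$, and $\mathsf{k}[T](x,y)=0$ if $\{x,y\}\notin T$. A vertex of a polytope is an extreme point. *)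

(* Defs.v *)
From HB Require Import structures.
From mathcomp Require Import all_boot all_order all_algebra.
From mathcomp Require Import boolp classical_sets reals interval_inference.
From mathcomp Require Import convex.

Set Implicit Arguments.
Unset Strict Implicit.
Unset Printing Implicit Defensive.

Import Order.TTheory GRing.Theory Num.Theory.
Local Open Scope ring_scope.

(* [set ...] denotes finite sets; classical sets are marked %classic. *)

(* The index type of R^E', the ordered pairs whose underlying pair is in E. *)
Notation dedge E := {a | [set a.1; a.2] \in E}.

Section Graphs.
Variable V : finType.

(* A graph on V is given by its edge set; edges are unordered pairs {x, y},
   and the loop {x, x} = {x} is excluded by the cardinality condition. *)
Definition simple_graph (E : {set {set V}}) : Prop :=
  forall e, e \in E -> #|e| = 2%N.

Definition adj (E : {set {set V}}) : rel V := fun x y => [set x; y] \in E.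

Definition connected_graph (E : {set {set V}}) : Prop :=
  forall x y : V, connect (adj E) x y.

(* The length bound excludes x :: y :: nil, which traverses one edge twice. *)
Definition acyclic (E : {set {set V}}) : Prop :=
  forall c : seq V, (2 < size c)%N -> ~ ucycle (adj E) c.

Definition forest_in (E F : {set {set V}}) : Prop :=
  F \subset E /\ acyclic F.

Definition spanning_tree (E T : {set {set V}}) : Prop :=
  [/\ T \subset E, connected_graph T & acyclic T].

Definition underlying_edge (E : {set {set V}}) (a : dedge E) : {set V} :=
  [set (val a).1; (val a).2].

Definition tail_component (T : {set {set V}}) (x y : V) : {set V} :=
  [set z | connect (adj (T :\ [set x; y])) x z].

End Graphs.

Definition prob_density (R : realType) (V : finType) (mu : V -> R) : Prop :=
  (forall x, 0 <= mu x) /\ \sum_x mu x = 1.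

(* R^o is R as a module over itself, so that {ffun dedge E -> R^o} is an
   R-vector space. *)
Definition canonical_embedding (R : realType) (V : finType)
    (E : {set {set V}}) (mu nu : V -> R) (T : {set {set V}}) :
    {ffun dedge E -> R^o} :=
  [ffun a : dedge E =>
     let x := (val a).1 in let y := (val a).2 in
     if [set x; y] \in T
     then Num.max (\sum_(z in tail_component T x y) (mu z - nu z)) 0
     else 0].
Arguments canonical_embedding {R V} E mu nu T.

Definition convex_hull (R : realType) (M : lmodType R) (A : set M) : set M :=
  smallest (@convex_set R M) A.

Definition extreme_point (R : realType) (M : lmodType R)
    (A : set M) (v : M) : Prop :=
  A v /\ forall (a b : M) (t : R), A a -> A b -> 0 < t < 1 ->
    v = t *: a + (1 - t) *: b -> a = v /\ b = v.

Definition tree_polytope (R : realType) (V : finType)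
    (E : {set {set V}}) (mu nu : V -> R) : set {ffun dedge E -> R^o} :=
  convex_hull
    [set canonical_embedding E mu nu T | T in [set T | spanning_tree E T]]%classic.
Arguments tree_polytope {R V} E mu nu.

Definition support_edges (R : realType) (V : finType)
    (E : {set {set V}}) (K : {ffun dedge E -> R^o}) : {set {set V}} :=
  [set e in E | [exists a : dedge E, (underlying_edge a == e) && (0 < K a)]].

(* Main.v *)
Require Import Defs.
From mathcomp Require Import all_boot all_order all_algebra.
From mathcomp Require Import boolp classical_sets reals convex.
From mathcomp Require Import interval_inference.

(** Write [f := mu - nu].  All the embeddings [k[T]] lie in the transport
    polytope of nonnegative arc values whose net outflow is [f x] at each
    vertex [x], and the proof shows that they are extreme points already there.
    The two facts behind this are the following.

    First, [k[T]] is a transport plan ([canonical_embedding_plan]): removing an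
    edge [{x, y}] from a tree leaves two complementary components, so the net
    flow of [k[T]] along [(x, y)] is [f(S_x) = - f(S_y)]; and the components
    [S_y], for [y] a neighbour of [x], partition the vertices other than [x],
    so that the outflow at [x] is [- f(V - x) = f x].

    Second, a transport plan carried by the edges of [T] that never uses both
    orientations of an edge equals [k[T]] ([plan_on_tree_unique]): the net
    flow out of [S_x] is [f(S_x)], and [{x, y}] is the only edge of [T] through
    which it can leave; without antiparallel flow the net flow determines the
    values of both orientations.

    For part (i), if [k[T]] is a proper convex combination of plans, then by
    nonnegativity those plans vanish where [k[T]] does, hence satisfy the
    conditions of the uniqueness result and equal [k[T]].  For part (ii), an
    extreme point of a convex hull is one of the generators, so [K = k[T0]] and
    its support lies in the tree [T0]; and any tree [T] that contains the
    support satisfies [K = k[T]], by the uniqueness result again. *)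

(** * Components of a tree minus an edge *)

Section TreeComponents.
Set Implicit Arguments.
Unset Strict Implicit.
Unset Printing Implicit Defensive.

Variables (V : finType) (T : {set {set V}}).

Lemma adjC : symmetric (adj T).
Proof. by move=> x y; rewrite /adj finset.setUC. Qed.

Lemma edge_neq x y : simple_graph T -> [set x; y] \in T -> x != y.
Proof. by move=> sT /sT; rewrite cards2; case: (x != y). Qed.

(** A simple path from [x] to [y] that avoids the edge [{x, y}] has length at
    least two, so that this edge closes it into a cycle. *)
Lemma bridge x y : simple_graph T -> acyclic T -> [set x; y] \in T ->
  ~~ connect (adj (T :\ [set x; y])) x y.
Proof.
move=> sT aT xyT; apply/negP => /connectP[p xp ylast].
move: ylast; case/shortenP: xp => q xq uq _ ylast.
have sub : subrel (adj (T :\ [set x; y])) (adj T).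
  by move=> u v; rewrite /adj finset.in_setD1 => /andP[].
case: q xq uq ylast => [_ _ /= yx|v [|w q] xq uq ylast].
- by have := edge_neq sT xyT; rewrite yx eqxx.
- by move: xq; rewrite /= ylast /= /adj finset.in_setD1 eqxx.
apply: (aT (x :: v :: w :: q)) => //; apply/andP; split=> //.
rewrite /cycle rcons_path (sub_path sub xq) -ylast.
by rewrite /adj finset.setUC.
Qed.

(** An edge that avoids [x] survives the removal of any edge at [x]. *)
Lemma connect_avoiding x y w p : path (adj T) w p -> x \notin w :: p ->
  connect (adj (T :\ [set x; y])) w (last w p).
Proof.
elim: p w => [|v p IHp] w /=; first by rewrite connect0.
case/andP=> wv vp; rewrite in_cons negb_or => /andP[xw xvp].
apply: connect_trans (IHp v vp xvp); apply: connect1.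
rewrite /adj finset.in_setD1; apply/andP; split=> //; apply: contraNneq xw => e.
have : x \in [set w; v] by rewrite e set21.
rewrite in_set2 => /orP[//|/eqP xv].
by move: xvp; rewrite in_cons xv eqxx.
Qed.

Hypotheses (sT : simple_graph T) (cT : connected_graph T) (aT : acyclic T).

Lemma adjD1_sym x y : connect_sym (adj (T :\ [set x; y])).
Proof. by apply: sym_connect_sym => u v; rewrite /adj finset.setUC. Qed.

(** Of the two orientations of the removed edge, only [(x, y)] starts in the
    component of [x], since that component does not contain [y]. *)
Lemma tail_component_exit x y u v : [set x; y] \in T -> [set u; v] \in T ->
  u \in tail_component T x y -> v \notin tail_component T x y ->
  (u, v) = (x, y).
Proof.
move=> xyT uvT; rewrite !inE => xu xv.
have [e|ne] := eqVneq [set u; v] [set x; y]; last first.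
  case/negP: xv; apply: connect_trans xu (connect1 _).
  by rewrite /adj finset.in_setD1 ne.
have vx : v != x by apply: contraNneq xv => ->; rewrite connect0.
have uy : u != y by apply: contraTneq xu => ->; apply: bridge.
have : u \in [set x; y] by rewrite -e set21.
have : v \in [set x; y] by rewrite -e set22.
by rewrite !in_set2 (negPf vx) (negPf uy) orbF => /eqP-> /eqP->.
Qed.

Lemma tail_componentC x y : [set x; y] \in T ->
  tail_component T y x = ~: tail_component T x y.
Proof.
move=> xyT; apply/setP => z; rewrite !inE [[set y; x]]finset.setUC.
apply/idP/idP => [yz|xz].
  apply: contra (bridge sT aT xyT) => xz.
  by apply: connect_trans xz _; rewrite adjD1_sym.
(* The union of both components is closed under adjacency, hence everything. *)
pose U := [pred z | connect (adj (T :\ [set x; y])) x z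
                  || connect (adj (T :\ [set x; y])) y z].
have closedU : closed (adj T) U.
  apply: intro_closed; first by apply: sym_connect_sym; apply: adjC.
  move=> u v uv; rewrite !inE => Uu.
  have [e|ne] := eqVneq [set u; v] [set x; y].
    have : v \in [set x; y] by rewrite -e set22.
    by rewrite in_set2 => /orP[]/eqP->; rewrite connect0 ?orbT.
  have uv' : connect (adj (T :\ [set x; y])) u v.
    by apply: connect1; rewrite /adj finset.in_setD1 ne.
  by case/orP: Uu => h; rewrite (connect_trans h uv') ?orbT.
have := closed_connect closedU (cT x z).
by rewrite !inE connect0 (negPf xz).
Qed.

(** The unique neighbour is the first step of a path in [T] from [x] to [z]. *)
Lemma neighbor_components x z : z != x ->
  exists w, forall y,
    ([set x; y] \in T) && (z \in tail_component T y x) = (y == w).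
Proof.
move=> zx; have /connectP[p xp zlast] := cT x z.
move: zlast; case/shortenP: xp => -[/= _ _ _ e|w q xq uq _ zlast].
  by rewrite e eqxx in zx.
case/andP: xq => /= xw wq; case/andP: uq => xq uq.
have wz y : connect (adj (T :\ [set x; y])) w z.
  by rewrite zlast; apply: connect_avoiding.
exists w => y; have [->|yw] := eqVneq y w.
  by rewrite -/(adj T x w) xw inE [[set w; x]]finset.setUC wz.
apply/negP => /andP[xyT]; rewrite tail_componentC // inE => /negP; apply.
rewrite inE; apply: connect_trans (wz y); apply: connect1.
rewrite /adj finset.in_setD1 [_ \in T]xw andbT; apply: contraNneq yw => e.
have : y \in [set x; w] by rewrite e set22.
by rewrite in_set2 => /orP[/eqP yx|//]; have := edge_neq sT xyT; rewrite yx eqxx.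
Qed.

End TreeComponents.

Lemma acyclicS (V : finType) (F T : {set {set V}}) :
  F \subset T -> acyclic T -> acyclic F.
Proof.
move=> /fintype.subsetP FT aT c c2 /andP[cF uc].
apply: (aT c c2); apply/andP; split=> //.
by case: c cF {c2 uc} => //= x c; apply: sub_path => u v /FT.
Qed.

(** * Transport plans *)

Section TransportPlans.
Set Implicit Arguments.
Unset Strict Implicit.
Unset Printing Implicit Defensive.
Import Order.TTheory GRing.Theory Num.Theory.
Local Open Scope ring_scope.

Variables (R : realType) (V : finType) (E : {set {set V}}).
Implicit Types K A B : {ffun dedge E -> R^o}.

(** The extension of [K] by zero to all pairs: the sum has at most one term. *)
Definition arc_value K (x y : V) : R := \sum_(a | val a == (x, y)) K a.

Definition net_flow K (x y : V) : R := arc_value K x y - arc_value K y x.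

Definition transport_plan (mu nu : V -> R) K : Prop :=
  (forall a, 0 <= K a) /\
  (forall x, \sum_y net_flow K x y = mu x - nu x).

Lemma arc_valueE K a : arc_value K (val a).1 (val a).2 = K a.
Proof.
by rewrite /arc_value -surjective_pairing (big_pred1 a) // => b; apply: val_eqE.
Qed.

Lemma arc_value_out K x y : [set x; y] \notin E -> arc_value K x y = 0.
Proof.
move=> xyE; apply: big_pred0 => a; apply: contraNF xyE => /eqP e.
by have := valP a; rewrite e.
Qed.

Lemma arc_value_lin (s t : R) A B x y :
  arc_value (s *: A + t *: B) x y = s * arc_value A x y + t * arc_value B x y.
Proof.
rewrite /arc_value !mulr_sumr -big_split /=; apply: eq_bigr => a _.
by rewrite !ffunE.
Qed.

Lemma net_flow_lin (s t : R) A B x y :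
  net_flow (s *: A + t *: B) x y = s * net_flow A x y + t * net_flow B x y.
Proof. by rewrite /net_flow !arc_value_lin !mulrBr opprD addrACA. Qed.

Lemma arc_value_ge0 K x y : (forall a, 0 <= K a) -> 0 <= arc_value K x y.
Proof. by move=> K0; apply: sumr_ge0. Qed.

Lemma transport_plan_convex mu nu :
  @convex_set R {ffun dedge E -> R^o} (transport_plan mu nu).
Proof.
move=> A B l /set_mem[A0 Ad] /set_mem[B0 Bd]; apply/mem_set.
set t := l%:inum; have t0 : 0 <= t by rewrite /t ge0.
have t1 : 0 <= 1 - t by rewrite subr_ge0 /t le1.
rewrite /conv /= -/t /unstable.onem; split=> [a|x].
  by rewrite !ffunE; apply: addr_ge0; apply: mulr_ge0.
under eq_bigr => y _ do rewrite net_flow_lin.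
by rewrite big_split /= -!mulr_sumr Ad Bd -mulrDl addrC subrK mul1r.
Qed.

(** Net flow is antisymmetric, so the arcs inside [S] cancel in pairs. *)
Lemma outflow_cut K (S : {set V}) :
  \sum_(u in S) \sum_v net_flow K u v =
  \sum_(u in S) \sum_(v in ~: S) net_flow K u v.
Proof.
have inner : \sum_(u in S) \sum_(v in S) net_flow K u v = 0.
  under eq_bigr => u _ do rewrite sumrB.
  by rewrite sumrB [X in _ - X]exchange_big subrr.
under eq_bigr => u _ do rewrite (bigID (mem S)) /=.
rewrite big_split /= inner add0r; apply: eq_bigr => u _.
by apply: eq_bigl => v; rewrite inE.
Qed.

(** * The canonical embedding is determined by its tree *)

Variables (mu nu : V -> R) (T : {set {set V}}).
Local Notation f := (fun z => mu z - nu z).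
Hypotheses (sE : simple_graph E) (tT : spanning_tree E T).

Let sub_TE : T \subset E. Proof. by case: tT. Qed.
Let sT : simple_graph T. Proof. by move=> e /(fintype.subsetP sub_TE)/sE. Qed.
Let cT : connected_graph T. Proof. by case: tT. Qed.
Let aT : acyclic T. Proof. by case: tT. Qed.

(** Everything that leaves [S_x] does so through the edge [{x, y}], so the net
    flow there is the total excess of [mu] over [nu] in [S_x]. *)
Lemma tree_net_flow K x y : transport_plan mu nu K ->
  (forall u v, [set u; v] \notin T -> arc_value K u v = 0) ->
  [set x; y] \in T -> net_flow K x y = \sum_(z in tail_component T x y) f z.
Proof.
move=> [_ divK] suppK xyT; set S := tail_component T x y.
have Sx : x \in S by rewrite inE connect0.
have Sy : y \in ~: S by rewrite -tail_componentC // inE connect0.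
have flow0 u v : u \in S -> v \in ~: S -> (u, v) != (x, y) ->
    net_flow K u v = 0.
  rewrite finset.in_setC => Su Sv; have [uvT|uvT] := boolP ([set u; v] \in T).
    by rewrite (tail_component_exit sT aT xyT uvT Su Sv) eqxx.
  by rewrite /net_flow !suppK ?subrr // finset.setUC.
under eq_bigr => z _ do rewrite -divK.
rewrite outflow_cut (bigD1 x) //= (bigD1 y) //= !big1 ?addr0 //.
- move=> u /andP[Su ux]; apply: big1 => v Sv; apply: flow0 => //.
  by apply: contraNneq ux => -[->].
- move=> v /andP[Sv vy]; apply: flow0 => //.
  by apply: contraNneq vy => -[->].
Qed.

Lemma arc_value_embedding x y :
  arc_value (canonical_embedding E mu nu T) x y =
  if [set x; y] \in T
  then Num.max (\sum_(z in tail_component T x y) f z) 0 else 0.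
Proof.
have [xyE|xyE] := boolP ([set x; y] \in E).
  pose a : dedge E := exist _ (x, y) xyE.
  by rewrite -[x]/(val a).1 -[y]/(val a).2 arc_valueE ffunE.
rewrite arc_value_out //; case: ifP => // /(fintype.subsetP sub_TE) xyE'.
by rewrite xyE' in xyE.
Qed.

(** The antiparallel condition is needed because adding the same amount to both
    orientations of an edge of [T] gives another plan carried by [T]. *)
Lemma plan_on_tree_unique K : transport_plan mu nu K ->
  (forall u v, [set u; v] \notin T -> arc_value K u v = 0) ->
  (forall u v, arc_value K u v = 0 \/ arc_value K v u = 0) ->
  K = canonical_embedding E mu nu T.
Proof.
move=> planK suppK antiK; have [K0 _] := planK.
apply/ffunP => a; rewrite -!arc_valueE arc_value_embedding.
move: (val a).1 (val a).2 => x y; case: ifP => [xyT|/negbT]; last exact: suppK.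
rewrite -(tree_net_flow planK suppK xyT) /net_flow; have [->|->] := antiK x y.
  by rewrite sub0r max_r // oppr_le0 arc_value_ge0.
by rewrite subr0 max_l // arc_value_ge0.
Qed.

(** * The canonical embedding is a transport plan *)

Hypothesis balance : \sum_z f z = 0.

Lemma tail_component_sumN x y : [set x; y] \in T ->
  \sum_(z in tail_component T y x) f z =
  - \sum_(z in tail_component T x y) f z.
Proof.
move=> xyT; apply/eqP; rewrite -addr_eq0 -[eqbRHS]balance addrC.
rewrite (tail_componentC _ _ _ xyT) //.
rewrite [eqbRHS](bigID (mem (tail_component T x y))) /=; apply/eqP.
by congr (_ + _); apply: eq_bigl => z; rewrite finset.in_setC.
Qed.

Lemma embedding_antiparallel x y :
  arc_value (canonical_embedding E mu nu T) x y = 0 \/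
  arc_value (canonical_embedding E mu nu T) y x = 0.
Proof.
rewrite !arc_value_embedding [[set y; x]]finset.setUC.
case: ifP => xyT; last by left.
rewrite (tail_component_sumN xyT).
case: (lerP (\sum_(z in tail_component T x y) f z) 0) => [|/ltW] s0.
  by left.
by right; rewrite max_r // oppr_le0.
Qed.

Lemma net_flow_embedding x y :
  net_flow (canonical_embedding E mu nu T) x y =
  if [set x; y] \in T then - \sum_(z in tail_component T y x) f z else 0.
Proof.
rewrite /net_flow !arc_value_embedding [[set y; x]]finset.setUC.
case: ifP => xyT; last by rewrite subrr.
rewrite (tail_component_sumN xyT) opprK.
case: (lerP (\sum_(z in tail_component T x y) f z) 0) => [|/ltW] s0.
  by rewrite max_l ?oppr_ge0 // sub0r opprK.
by rewrite max_r ?oppr_le0 // subr0.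
Qed.

(** The outflow at [x] is minus the sum of [f] over the components [S_y] of the
    neighbours [y] of [x].  Exchanging the sums counts each vertex [z] once for
    every neighbour [y] with [z] in [S_y]: never for [z = x], and exactly once
    otherwise. *)
Lemma canonical_embedding_plan :
  transport_plan mu nu (canonical_embedding E mu nu T).
Proof.
split=> [a|x].
  rewrite -arc_valueE arc_value_embedding; case: ifP => // _.
  by rewrite le_max lexx orbT.
under eq_bigr => y _ do rewrite net_flow_embedding.
rewrite -big_mkcond /= sumrN.
rewrite (exchange_big_dep predT) //= (bigD1 x) //=.
rewrite [X in X + _]big_pred0 ?add0r; last first.
  move=> y; apply/negP => /andP[xyT].
  by rewrite tail_componentC // !inE connect0.
rewrite (eq_bigr f) => [|z zx]; last first.
  by have [w Ew] := neighbor_components sT cT aT zx; rewrite (big_pred1 w).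
apply/eqP; rewrite eq_sym -addr_eq0 -[eqbRHS]balance [eqbRHS](bigD1 x) //=.
Qed.

(** Both terms of the combination are nonnegative, so [A] vanishes wherever the
    embedding does and inherits from it the conditions that determine a plan. *)
Lemma embedding_face A B t : transport_plan mu nu A -> transport_plan mu nu B ->
  0 < t < 1 -> canonical_embedding E mu nu T = t *: A + (1 - t) *: B ->
  A = canonical_embedding E mu nu T.
Proof.
move=> planA [B0 _] /andP[t0 t1] eqk; have [A0 _] := planA.
have suppA x y : arc_value (canonical_embedding E mu nu T) x y = 0 ->
    arc_value A x y = 0.
  move/eqP; rewrite eqk arc_value_lin.
  have Ax := arc_value_ge0 x y A0; have Bx := arc_value_ge0 x y B0.
  have t1' : 0 <= 1 - t by rewrite subr_ge0 ltW.
  rewrite paddr_eq0 ?mulr_ge0 ?(ltW t0) // mulf_eq0 (gt_eqF t0) /=.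
  by case/andP=> /eqP.
apply: plan_on_tree_unique => // [u v uvT|u v].
  by apply: suppA; rewrite arc_value_embedding (negPf uvT).
by have [/suppA|/suppA] := embedding_antiparallel u v; [left|right].
Qed.

Lemma support_embedding :
  support_edges (canonical_embedding E mu nu T) \subset T.
Proof.
apply/fintype.subsetP => e; rewrite inE => /andP[_ /existsP[a /andP[/eqP <-]]].
by rewrite ffunE /underlying_edge; case: ifP => //; rewrite ltxx.
Qed.

Lemma arc_value_support K u v : (forall a, 0 <= K a) ->
  support_edges K \subset T -> [set u; v] \notin T -> arc_value K u v = 0.
Proof.
move=> K0 /fintype.subsetP sK uvT; rewrite /arc_value big1 // => a /eqP ea.
apply/eqP; rewrite eq_le K0 andbT leNgt; apply: contra uvT => Ka.
apply: sK; rewrite inE; have := valP a; rewrite /= ea /= => -> /=.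
by apply/existsP; exists a; rewrite /underlying_edge ea eqxx.
Qed.

End TransportPlans.

(** * Extreme points of convex hulls *)

Section ConvexHulls.
Set Implicit Arguments.
Unset Strict Implicit.
Unset Printing Implicit Defensive.
Import Order.TTheory GRing.Theory Num.Theory.
Local Open Scope ring_scope.
Local Open Scope classical_set_scope.

(** Removing an extreme point from a convex set leaves it convex; were the point
    not a generator, this would be a smaller convex set containing them all. *)
Lemma extreme_point_hull (R : realType) (M : lmodType R) (A : set M) (v : M) :
  extreme_point (convex_hull A) v -> A v.
Proof.
case=> hv ext; apply: contrapT => Av.
have [] : ([set w | convex_hull A w /\ w <> v]) v; last by [].
apply: hv; split; last first.
  by move=> w Aw; split; [move=> C [_]; apply|move=> wv; apply: Av; rewrite -wv].
apply/convex_setW => a b /set_mem[ha av] /set_mem[hb bv] l l0 l1.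
apply/mem_set; split.
  move=> C CA; apply/set_mem.
  by apply: CA.1; apply/mem_set; [apply: ha|apply: hb].
rewrite /conv /= /unstable.onem => e; apply: av.
by have [||] := ext a b l%:num ha hb; rewrite ?l0 ?l1.
Qed.

End ConvexHulls.

(** * Vertices of the tree polytope *)

Theorem proposition1p1 (R : realType) (V : finType) (E : {set {set V}})
    (hE : simple_graph E) (hconn : connected_graph E)
    (mu nu : V -> R) (hmu : prob_density mu) (hnu : prob_density nu) :
  (forall T : {set {set V}}, spanning_tree E T ->
     extreme_point (tree_polytope E mu nu) (canonical_embedding E mu nu T))
  /\
  (forall K : {ffun dedge E -> R^o}, extreme_point (tree_polytope E mu nu) K ->
     [/\ exists T : {set {set V}},
           spanning_tree E T /\ K = canonical_embedding E mu nu T,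
         forest_in E (support_edges K)
       & [set T | spanning_tree E T /\ canonical_embedding E mu nu T = K]%classic
         = [set T | spanning_tree E T /\ support_edges K \subset T]%classic]).
Proof.
have balance : (\sum_z (mu z - nu z) = 0)%R.
  by rewrite GRing.sumrB hmu.2 hnu.2 GRing.subrr.
have polytope_plan K : tree_polytope E mu nu K -> transport_plan mu nu K.
  apply; split; first exact: transport_plan_convex.
  by move=> _ [T tT <-]; apply: canonical_embedding_plan.
split=> [T tT|K /extreme_point_hull[T0 tT0 <-]].
  split; first by move=> C [_]; apply; exists T.
  move=> A B t /polytope_plan planA /polytope_plan planB t01 e.
  split; first exact: embedding_face planB t01 e.
  apply: (embedding_face hE tT balance planB planA (t := (1 - t)%R)).
    by rewrite Num.Theory.subr_gt0 Num.Theory.gtrBl andbC.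
  by rewrite GRing.subKr GRing.addrC.
have suppT0 := @support_embedding R V E mu nu T0.
have [TE0 _ aT0] := tT0.
split; first by exists T0.
  by split; [apply: fintype.subset_trans suppT0 TE0|apply: acyclicS suppT0 aT0].
apply/seteqP; split=> T [tT].
  by move=> <-; split=> //; apply: support_embedding.
have planK := canonical_embedding_plan hE tT0 balance.
move=> suppT; split=> //; symmetry; apply: plan_on_tree_unique => //.
  by move=> u v; apply: arc_value_support planK.1 suppT.
exact: embedding_antiparallel.
Qed.
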